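(* Consider on the torus $\mathbb{T}^2$ the semidirect product Euler–Euler system $$\partial_t\omega_1 + (u_1\cdot\nabla)\omega_1 + (u_2\cdot\nabla)\omega_2 = 0,\qquad \partial_t\omega_2 + (u_1+u_2)\cdot\nabla\omega_2 = 0,$$ where $u_i=-\nabla^{\perp}\psi_i$ and $\omega_i=-\Delta\psi_i$ for $i=1,2$. The system can be written as $$\partial_t(\omega_1-\omega_2) + (u_1\cdot\nabla)(\omega_1-\omega_2)=0,\qquad \partial_t\omega_2 + (u_1+u_2)\cdot\nabla\omega_2=0.$$ This gives, for arbitrary $f,g$, the conservation laws (that is, the following quantity is conserved in time) $$C_{f,g}=\int f(\omega_1-\omega_2)+g(\omega_2)\,d^2x.$$ These imply, for any norm or seminorm $\|\cdot\|$, $$\|\omega_1(t)-\omega_2(t)\|=\|\omega_1(0)-\omega_2(0)\|,\qquad \|\omega_2(t)\|=\|\omega_2(0)\|,$$ and therefore $$\|\omega_1(t)\|\le\|\omega_1(t)-\omega_2(t)\|+\|\omega_2(t)\|\le\|\omega_1(0)-\omega_2(0)\|+\|\omega_2(0)\|\le\|\omega_1(0)\|+2\|\omega_2(0)\|.$$ In particular, the maximum value of vorticity is bounded for all time by the initial condition: $$\|\omega_1(t)\|_{\infty}\le\|\omega_1(0)\|_{\infty}+2\|\omega_2(0)\|_{\infty},\qquad \|\omega_2(t)\|_{\infty}\le\|\omega_2(0)\|_{\infty}.$$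
   Context: $\mathbb{T}^2$ is the two-dimensional torus. The unknowns $\omega_1,\omega_2$ are scalar vorticities, $\psi_1,\psi_2$ the corresponding stream functions, and $u_1,u_2$ the corresponding divergence-free velocity fields; $\nabla^{\perp}$ is the skew gradient, with the sign convention $\operatorname{curl}(-\nabla^{\perp}\psi)=-\Delta\psi$. $\omega_i(t)$ denotes the function $\omega_i$ on $\mathbb{T}^2$ at time $t$, $f,g$ are functions of one real variable, the integral is over $\mathbb{T}^2$, and $\|\cdot\|_{\infty}$ is the maximum (supremum) norm over $\mathbb{T}^2$. The system is the vorticity–stream-function form of the geodesic (Euler–Poincaré) equations on the semidirect product of the group of volume-preserving diffeomorphisms of $\mathbb{T}^2$ with itself (acting by conjugation), for the Lagrangian $\ell=\tfrac12(\|u_1\|_{2}^2+\|u_2\|_{2}^2)$, where $\|\cdot\|_2$ is the $L^2$ norm.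
   Formalization: ''Any norm or seminorm'' is false (e.g. the absolute value at a point, for ω₂=0 and non-steady 2D Euler); it is proved for all seminorms on continuous functions on the torus that depend only on the distribution of values, including the L^p and maximum norms. *)

(* Defs.v *)
From HB Require Import structures.
From mathcomp Require Import all_boot all_order all_algebra.
From mathcomp Require Import all_classical all_reals all_analysis.

Set Implicit Arguments.
Unset Strict Implicit.
Unset Printing Implicit Defensive.

Import Order.TTheory GRing.Theory Num.Theory.
Import numFieldNormedType.Exports.

Local Open Scope classical_set_scope.
Local Open Scope ring_scope.

(* The torus T^2 is R^2 / Z^2: a function on T^2 is a function on R * R that is
   1-periodic in each coordinate, and the integral over T^2 is the Lebesgue
   integral over the fundamental domain [0, 1]^2 (whose boundary is null). *)

Definition periodic2 (R : realType) (a : R * R -> R) : Prop :=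
  forall x y : R, a (x + 1, y) = a (x, y) /\ a (x, y + 1) = a (x, y).

Definition torus_cell (R : realType) : set (R * R) := `[0, 1] `*` `[0, 1].

Definition lebesgue2 (R : realType) : set (R * R) -> \bar R :=
  ((@lebesgue_measure R) \x (@lebesgue_measure R))%E.
Arguments lebesgue2 R : clear implicits.
Arguments torus_cell R : clear implicits.

Definition continuous_torus (R : realType) (a : R * R -> R) : Prop :=
  continuous a /\ periodic2 a.

Definition dx (R : realType) (a : R * R -> R) : R * R -> R :=
  fun z => derive1 (fun s : R => a (s, z.2)) z.1.

Definition dy (R : realType) (a : R * R -> R) : R * R -> R :=
  fun z => derive1 (fun s : R => a (z.1, s)) z.2.

Definition dt (R : realType) (w : R -> R * R -> R) : R -> R * R -> R :=
  fun t z => derive1 (fun s : R => w s z) t.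

Definition has_partials (R : realType) (a : R * R -> R) : Prop :=
  forall z : R * R, derivable (fun s : R => a (s, z.2)) z.1 1 /\
                    derivable (fun s : R => a (z.1, s)) z.2 1.

Definition C1_space (R : realType) (a : R * R -> R) : Prop :=
  [/\ continuous a, has_partials a, continuous (dx a) & continuous (dy a)].

Definition C2_space (R : realType) (a : R * R -> R) : Prop :=
  [/\ C1_space a, C1_space (dx a) & C1_space (dy a)].

Definition laplacian (R : realType) (a : R * R -> R) : R * R -> R :=
  dx (dx a) \+ dy (dy a).

Definition gradperp (R : realType) (a : R * R -> R) : R * R -> R * R :=
  fun z => (- dy a z, dx a z).

(* curl (v1, v2) = dx v2 - dy v1, so that curl (velocity psi) = - laplacian psi
   for the above sign of gradperp. *)
Definition velocity (R : realType) (psi : R * R -> R) : R * R -> R * R :=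
  fun z => - gradperp psi z.

(* (u . nabla) a *)
Definition advect (R : realType) (u : R * R -> R * R) (a : R * R -> R) :
    R * R -> R :=
  fun z => (u z).1 * dx a z + (u z).2 * dy a z.

(* Lifespan [0, T) with T in (0, +oo]; T = +oo gives global solutions. *)
Definition lifespan (R : realType) (T : \bar R) : set R :=
  [set t | 0 <= t /\ (t%:E < T)%E].

Definition open_lifespan (R : realType) (T : \bar R) : set R :=
  [set t | 0 < t /\ (t%:E < T)%E].

(* w is in C([0, T) x T^2) and in C^1((0, T) x T^2). *)
Record vorticity_regular (R : realType) (T : \bar R) (w : R -> R * R -> R) :
    Prop := VorticityRegular {
  vr_periodic : forall t, lifespan T t -> periodic2 (w t);
  vr_continuous :
    {within lifespan T `*` setT, continuous (fun p : R * (R * R) => w p.1 p.2)};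
  vr_derivable_t : forall t z, open_lifespan T t ->
    derivable (fun s : R => w s z) t 1;
  vr_partials : forall t, open_lifespan T t -> has_partials (w t);
  vr_continuous_dt : forall p : R * (R * R), open_lifespan T p.1 ->
    {for p, continuous (fun q : R * (R * R) => dt w q.1 q.2)};
  vr_continuous_dx : forall p : R * (R * R), open_lifespan T p.1 ->
    {for p, continuous (fun q : R * (R * R) => dx (w q.1) q.2)};
  vr_continuous_dy : forall p : R * (R * R), open_lifespan T p.1 ->
    {for p, continuous (fun q : R * (R * R) => dy (w q.1) q.2)}
}.

(* psi(t) is a C^2 stream function on T^2 of the vorticity w(t). *)
Definition stream_function (R : realType) (T : \bar R)
    (psi w : R -> R * R -> R) : Prop :=
  forall t, lifespan T t ->
    [/\ periodic2 (psi t), C2_space (psi t) &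
        forall z, w t z = - laplacian (psi t) z].

Definition euler_euler (R : realType) (T : \bar R)
    (psi1 psi2 w1 w2 : R -> R * R -> R) : Prop :=
  forall t z, open_lifespan T t ->
    dt w1 t z + advect (velocity (psi1 t)) (w1 t) z
      + advect (velocity (psi2 t)) (w2 t) z = 0 /\
    dt w2 t z + advect (velocity (psi1 t) \+ velocity (psi2 t)) (w2 t) z = 0.

Definition transport_system (R : realType) (T : \bar R)
    (psi1 psi2 w1 w2 : R -> R * R -> R) : Prop :=
  forall t z, open_lifespan T t ->
    dt (fun s => w1 s \- w2 s) t z
      + advect (velocity (psi1 t)) (w1 t \- w2 t) z = 0 /\
    dt w2 t z + advect (velocity (psi1 t) \+ velocity (psi2 t)) (w2 t) z = 0.

(* C_{f,g} at vorticities w1, w2 *)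
Definition casimir (R : realType) (f g : R -> R) (w1 w2 : R * R -> R) : R :=
  \int[lebesgue2 R]_(z in torus_cell R) (f (w1 z - w2 z) + g (w2 z)).

Definition integrable_torus (R : realType) (a : R * R -> R) : Prop :=
  (lebesgue2 R).-integrable (torus_cell R) (EFin \o a).

Definition seminorm_torus (R : realType) (N : (R * R -> R) -> R) : Prop :=
  (forall a b, continuous_torus a -> continuous_torus b ->
     N (a \+ b) <= N a + N b) /\
  (forall (c : R) a, continuous_torus a -> N (fun z => c * a z) = `|c| * N a).

Definition equimeasurable (R : realType) (a b : R * R -> R) : Prop :=
  forall s : R,
    lebesgue2 R (torus_cell R `&` [set z | s < a z]) =
    lebesgue2 R (torus_cell R `&` [set z | s < b z]).

(* The integrals of f(a), f arbitrary, only see the distribution of the values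
   of a, so the (semi)norms they control are those that depend only on this
   distribution. A general seminorm, e.g. |a(0, 0)| or a Sobolev seminorm, is
   not preserved. Using the signed distribution rather than that of |a| also
   admits seminorms such as |int a| and max a - min a. *)
Definition rearrangement_invariant (R : realType) (N : (R * R -> R) -> R) :
    Prop :=
  forall a b, continuous_torus a -> continuous_torus b ->
    equimeasurable a b -> N a = N b.

(* A genuine supremum on continuous periodic functions, which are bounded. *)
Definition norm_sup (R : realType) (a : R * R -> R) : R :=
  sup (range (fun z => `|a z|)).

(* Main.v *)
Require Import Defs.
From HB Require Import structures.
From mathcomp Require Import all_boot all_order all_algebra.
From mathcomp Require Import all_classical all_reals all_analysis.
From mathcomp Require Import measurable_realfun ring lra.

Set Implicit Arguments.
Unset Strict Implicit.
Unset Printing Implicit Defensive.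

Import Order.TTheory GRing.Theory Num.Theory.
Import numFieldNormedType.Exports.

Local Open Scope classical_set_scope.
Local Open Scope ring_scope.

(* Subtracting the two equations of the system shows that [w1 - w2] is
   transported by [velocity psi1] and [w2] by [velocity (psi1 + psi2)]; both
   fields are divergence free. For a C^1 function [f] and a scalar [a]
   transported by a divergence-free field [u], the derivative of the integral of
   [f(a)] is minus the integral of [u . nabla (f(a))], which vanishes by
   Clairaut's theorem, Fubini's theorem and periodicity. Letting [f] increase to
   the indicator of [s < v] shows that the distribution of [a(t)] on the torus
   does not depend on [t]. This gives the conservation of the integral of any
   measurable [f(a)] and of any rearrangement-invariant seminorm; the supremum
   norm is one of these, since a nonempty open subset of the torus has positive
   measure. *)

(* [lebesgue2 R] lives on [R * R] with its canonical measurable structure, while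
   [lebesgue_measure] lives on [measurableTypeR R]; the two structures have the
   same measurable sets but different displays, so that integrals over them are
   not convertible. *)
Section lebesgue2_measure.
Variable R : realType.
Local Notation mu2 := ((@lebesgue_measure R) \x (@lebesgue_measure R))%E.

HB.instance Definition _ :=
  @isMeasure.Build _ (R * R)%type _ (lebesgue2 R)
    (measure0 mu2) (measure_ge0 mu2) (@measure_semi_sigma_additive _ _ _ mu2).

Lemma integral_lebesgue2 (D : set (R * R)) (f : R * R -> \bar R) :
  measurable D -> measurable_fun setT f ->
  (\int[lebesgue2 R]_(z in D) f z = \int[mu2]_(z in D) f z)%E.
Proof.
move=> mD mf.
have ge0_eq (g : R * R -> \bar R) : measurable_fun setT g ->
    (forall z, 0 <= g z)%E ->
    (\int[lebesgue2 R]_(z in D) g z = \int[mu2]_(z in D) g z)%E.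
  move=> mg g0.
  (* The identity is measurable from one structure to the other, and [lebesgue2 R] is the
     pushforward of [mu2] along it. *)
  exact: (@ge0_integral_pushforward _ _
    (measurableTypeR R * measurableTypeR R)%type (R * R)%type R idfun
    (@measurable_id _ _ _) mu2 D g mD (measurable_funTS mg) (fun z _ => g0 z)).
rewrite integralE [RHS]integralE; congr (_ - _)%E.
- exact: ge0_eq (measurable_funepos mf) (funepos_ge0 f).
- exact: ge0_eq (measurable_funeneg mf) (funeneg_ge0 f).
Qed.

End lebesgue2_measure.

(** * Measurability and integrability of continuous functions on the cell *)

Section Torus.
Context {R : realType}.
Implicit Types (a b h psi : R * R -> R).

(** Boxes with rational centres and radii [1 / (n + 1)] form a countable basis of the plane, and
    each box is a measurable rectangle. *)
Lemma open_measurable2 (U : set (R * R)) : open U -> measurable U.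
Proof.
move=> oU.
pose box (i : rat * rat * nat) : set (R * R) :=
  ball (ratr i.1.1 : R) i.2.+1%:R^-1 `*` ball (ratr i.1.2 : R) i.2.+1%:R^-1.
(* Boxes that leave [U] are replaced by the empty set, so that the union runs over the whole
   countable index type. *)
have -> : U = \bigcup_i (if `[< box i `<=` U >] then box i else set0).
  apply/seteqP; split => [[x y] Uxy|z [i _]]; last first.
    by case: asboolP => // iU; exact: iU.
  have [e /= e0 xyU] : exists2 e : R, 0 < e & ball (x, y) e `<=` U.
    by move: oU; rewrite openE => /(_ _ Uxy) /nbhs_ballP.
  have [n _ /(_ n (leqnn n)) /= ne] :=
    near_infty_natSinv_lt (PosNum (divr_gt0 e0 (ltr0Sn R 1))).
  have n0 : 0 < n.+1%:R^-1 :> R by rewrite invr_gt0.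
  have approx (t : R) : exists q : rat, ball t n.+1%:R^-1 (ratr q : R).
    have [s [ts [q _ qs]]] := @dense_rat R (ball t n.+1%:R^-1)
      (ex_intro _ t (ballxx t n0)) (ball_open _ _).
    by exists q; rewrite qs.
  have [[q xq] [r yr]] := (approx x, approx y).
  have boxU : box (q, r, n) `<=` U.
    move=> [s t] [/= qs rt]; apply: xyU.
    have half (u v w : R) :
        ball u n.+1%:R^-1 v -> ball v n.+1%:R^-1 w -> ball u e w.
      move=> uv vw; apply: le_ball (ball_triangle uv vw).
      by rewrite [leRHS](splitr e) lerD// ltW.
    by split; [exact: half qs|exact: half rt].
  exists (q, r, n) => //; move/asboolP: boxU => ->.
  by split; exact: ball_sym.
apply: countable_bigcupT_measurable; first exact: countableP.
move=> i; case: asboolP => // _.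
by apply: measurableX; exact: measurable_ball.
Qed.

Lemma continuous_measurable2 a : continuous a -> measurable_fun setT a.
Proof.
move=> /continuousP ca.
apply: (measurability (@RGenOInfty.G R)); first exact: RGenOInfty.measurableE.
move=> _ [_ [r ->] <-]; rewrite setTI set_itvE; apply: open_measurable2.
by apply: ca; exact: open_gt.
Qed.

Lemma measurable_torus_cell : measurable (torus_cell R).
Proof. exact: measurableX. Qed.

Lemma compact_torus_cell : compact (torus_cell R).
Proof. by apply: compact_setX; exact: segment_compact. Qed.

Lemma lebesgue2_torus_cell : lebesgue2 R (torus_cell R) = 1%E.
Proof.
rewrite /lebesgue2 /torus_cell product_measure1E//=.
by rewrite lebesgue_measure_itv/= lte_fin ltr01 -EFinB subr0 mule1.
Qed.

Lemma bounded_integrable_torus a (M : R) : measurable_fun setT a ->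
  (forall z, torus_cell R z -> `|a z| <= M) -> integrable_torus a.
Proof.
move=> ma aM; 
apply: measurable_bounded_integrable.
- exact: measurable_torus_cell.
- by rewrite [ltLHS]lebesgue2_torus_cell ltry.
- exact: measurable_funTS.
- exists M; split; first exact: num_real.
  by move=> N MN z /aM zM; exact: le_trans zM (ltW MN).
Qed.

Lemma continuous_bounded_torus a : continuous a ->
  exists M, forall z, torus_cell R z -> `|a z| <= M.
Proof.
move=> ca.
have cell0 : torus_cell R !=set0.
  by exists (0, 0); split; rewrite /= in_itv/= lexx ler01.
have [z _ zmax] := @compact_EVT_max _ _ (fun z => `|a z|) _ cell0
  compact_torus_cell (continuous_subspaceT (fun z => cvg_norm (ca z))).
by exists `|a z| => t ct; apply: zmax; rewrite inE.
Qed.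

Lemma continuous_integrable_torus a : continuous a -> integrable_torus a.
Proof.
move=> ca; have [M aM] := continuous_bounded_torus ca.
exact: bounded_integrable_torus (continuous_measurable2 ca) aM.
Qed.

End Torus.

(** * Mean value theorem, fundamental theorem of calculus and Clairaut's theorem *)

Section Calculus.
Context {R : realType}.
Implicit Types (a b h psi : R * R -> R).

Lemma continuous_slice1 a (y : R) : continuous a -> continuous (fun s => a (s, y)).
Proof.
move=> ca s; apply: (@continuous_comp _ _ _ (fun s : R => (s, y)) a); last exact: ca.
exact: (@cvg_pair _ _ _ (nbhs s) (nbhs s) (nbhs y) _ _ _ id (cst y) cvg_id (cvg_cst y)).
Qed.

Lemma continuous_slice2 a (x : R) : continuous a -> continuous (fun s => a (x, s)).
Proof.
move=> ca s; apply: (@continuous_comp _ _ _ (fun s : R => (x, s)) a); last exact: ca.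
exact: (@cvg_pair _ _ _ (nbhs s) (nbhs x) (nbhs s) _ _ _ (cst x) id (cvg_cst x) cvg_id).
Qed.

Lemma MVT_derivable (f : R -> R) (u v : R) : u < v ->
  (forall x, derivable f x 1) ->
  exists2 c, c \in `]u, v[ & f v - f u = derive1 f c * (v - u).
Proof.
move=> uv df; apply: (@MVT R f (derive1 f) u v uv).
  by move=> x _; rewrite derive1E; exact/derivableP.
by apply: derivable_within_continuous => x _.
Qed.

Lemma FTC2_derivable (f : R -> R) (u v : R) : u < v ->
  (forall x, derivable f x 1) -> continuous (derive1 f) ->
  (\int[lebesgue_measure]_(x in `[u, v]) (derive1 f x)%:E = (f v - f u)%:E)%E.
Proof.
move=> uv df cf'; rewrite EFinB.
apply: (@continuous_FTC2 R (derive1 f) f u v uv).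
- exact: continuous_subspaceT.
- have cf : continuous f.
    by move=> x; apply/differentiable_continuous/derivable1_diffP.
  split=> //.
  + exact: cvg_at_right_filter (cf u).
  + exact: cvg_at_left_filter (cf v).
- by move=> x _.
Qed.

Lemma continuous_ball a z (e : R) : continuous a -> 0 < e ->
  exists2 r : R, 0 < r & forall w, ball z r w -> `|a z - a w| < e.
Proof.
move=> ca e0; have /cvgrPdist_lt/(_ e e0)/nbhs_ballP[r /= r0 zr] := ca z.
by exists r.
Qed.

(** The mean value theorem is used twice: in the first variable for [psi (s, y + k) - psi (s, y)],
    which yields [s], then in the second variable for [dx psi (s, _)]. *)
Lemma mixed_difference psi (x y k : R) : 0 < k ->
  has_partials psi -> has_partials (dx psi) ->
  exists z : R * R, [/\ x < z.1 < x + k, y < z.2 < y + k &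
    psi (x + k, y + k) - psi (x, y + k) - (psi (x + k, y) - psi (x, y)) =
    dy (dx psi) z * k * k].
Proof.
move=> k0 hp hdx.
have dphi (s : R) : is_derive s 1 (fun s => psi (s, y + k) - psi (s, y))
    (dx psi (s, y + k) - dx psi (s, y)).
  by apply: is_deriveB; rewrite /dx derive1E; apply/derivableP;
    [exact: (hp (s, y + k)).1 | exact: (hp (s, y)).1].
have xk : x < x + k by rewrite ltrDl.
have yk : y < y + k by rewrite ltrDl.
have [s sx] := MVT_derivable xk (fun s => ex_derive (is_derive := dphi s)).
rewrite derive1E derive_val => Dx.
have [t ty Dy] := MVT_derivable yk (fun t => (hdx (s, t)).2).
exists (s, t); split; [by rewrite in_itv in sx|by rewrite in_itv in ty|].
move: Dx; rewrite /= Dy !(addrAC _ k) !subrr !add0r => <-.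
ring.
Qed.

(** This is [mixed_difference] for [psi] with its two variables exchanged. *)
Lemma mixed_difference_swap psi (x y k : R) : 0 < k ->
  has_partials psi -> has_partials (dy psi) ->
  exists z : R * R, [/\ x < z.1 < x + k, y < z.2 < y + k &
    psi (x + k, y + k) - psi (x + k, y) - (psi (x, y + k) - psi (x, y)) =
    dx (dy psi) z * k * k].
Proof.
move=> k0 hp hdy.
have [[t s] [/= ht hs st]] := @mixed_difference
  (fun z => psi (z.2, z.1)) y x k k0
  (fun z => conj (hp (z.2, z.1)).2 (hp (z.2, z.1)).1)
  (fun z => conj (hdy (z.2, z.1)).2 (hdy (z.2, z.1)).1).
by exists (s, t).
Qed.

(** If [A] and [B] differed at a point, both would vary by less than half of the gap on a small
    square cornered there, so no value of [A] on it could equal a value of [B]. *)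
Lemma continuous_eq_cells (A B : R * R -> R) : continuous A -> continuous B ->
  (forall x y k, 0 < k -> exists z w : R * R,
    [/\ x < z.1 < x + k, y < z.2 < y + k, x < w.1 < x + k, y < w.2 < y + k &
        A z = B w]) -> A = B.
Proof.
move=> cA cB AB; apply/funext => -[x y].
apply/eqP; rewrite -subr_eq0; apply/negPn/negP => neq0.
pose e := `|A (x, y) - B (x, y)| / 2.
have e0 : 0 < e by rewrite divr_gt0// normr_gt0.
have [r r0 rA] := continuous_ball (x, y) cA e0.
have [r' r'0 rB] := continuous_ball (x, y) cB e0.
pose k := Num.min r r'.
have k0 : 0 < k by rewrite lt_min r0.
have in_ball (s t : R) : x < s < x + k -> y < t < y + k -> ball (x, y) k (s, t).
  move=> /andP[s1 s2] /andP[t1 t2]; split; rewrite /ball/= ltr_norml; lra.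
have [[s' t'] [[s t] [/= hs' ht' hs ht ABst]]] := AB x y k k0.
have dA : `|A (x, y) - A (s', t')| < e.
  by apply: rA; apply: le_ball (in_ball _ _ hs' ht'); rewrite ge_min lexx.
have dB : `|B (x, y) - B (s, t)| < e.
  by apply: rB; apply: le_ball (in_ball _ _ hs ht); rewrite ge_min lexx orbT.
have : `|A (x, y) - B (x, y)| < e + e.
  rewrite -(subrKA (B (s, t))) (le_lt_trans (ler_normD _ _))// ltrD//.
    by rewrite -ABst.
  by rewrite distrC.
by rewrite -splitr ltxx.
Qed.

(** The second difference of [psi] over a square does not depend on the order of differencing.
    Divided by [k * k], it is a value of each mixed derivative inside the square, though perhaps at
    different points. *)
Lemma clairaut psi : C2_space psi -> dx (dy psi) = dy (dx psi).
Proof.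
move=> [[_ hp _ _] [_ hdx _ cyx] [_ hdy cxy _]].
apply: continuous_eq_cells => // x y k k0.
have [z [z1 z2 Dz]] := mixed_difference_swap x y k0 hp hdy.
have [w [w1 w2 Dw]] := mixed_difference x y k0 hp hdx.
exists z, w; split; [exact: z1|exact: z2|exact: w1|exact: w2|].
apply: (mulIf (lt0r_neq0 k0)); apply: (mulIf (lt0r_neq0 k0)).
move: Dz Dw; move: (dx (dy psi) z) (dy (dx psi) w) => A B <- <-.
move: (psi (x + k, y + k)) (psi (x + k, y)) (psi (x, y + k)) (psi (x, y)).
by move=> p q u v; ring.
Qed.

End Calculus.

(** * Integrals of derivatives of periodic functions vanish *)

Section Divergence.
Context {R : realType}.
Local Notation mu := (@lebesgue_measure R).
Implicit Types (a h psi : R * R -> R).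

Lemma integrable_product_torus a : continuous a ->
  (mu \x mu)%E.-integrable (torus_cell R) (EFin \o a).
Proof.
move=> ca; have [M aM] := continuous_bounded_torus ca.
apply: measurable_bounded_integrable.
- exact: measurable_torus_cell.
- by rewrite [ltLHS]lebesgue2_torus_cell ltry.
- exact: measurable_funTS (continuous_measurable2 ca).
- exists M; split; first exact: num_real.
  by move=> N MN z /aM zM; exact: le_trans zM (ltW MN).
Qed.

(** Extension by zero turns an integral over the cell into one over the plane, the form in which
    Fubini's theorem is applied below. *)
Lemma integrable_patch_torus a : continuous a ->
  (mu \x mu)%E.-integrable setT ((EFin \o a) \_ (torus_cell R)).
Proof.
move=> ca; apply: (@integrable_mkcond _ _ _ (mu \x mu)%E (torus_cell R)
  (EFin \o a) measurable_torus_cell).1.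
exact: integrable_product_torus.
Qed.

Lemma integral_torus_patch a : continuous a ->
  (\int[lebesgue2 R]_(z in torus_cell R) (a z)%:E =
   \int[(mu \x mu)%E]_z ((EFin \o a) \_ (torus_cell R)) z)%E.
Proof.
move=> ca; rewrite -integral_mkcond; apply: integral_lebesgue2.
- exact: measurable_torus_cell.
- by apply/measurable_EFinP; exact: continuous_measurable2.
Qed.

(** With the integration in [x] performed first, each inner integral is [P (1, y) - P (0, y)], which
    is zero by periodicity, or the integral of zero when [y] is outside the unit interval. *)
Lemma integral_torus_dx (P : R * R -> R) : has_partials P ->
  continuous (dx P) -> periodic2 P ->
  \int[lebesgue2 R]_(z in torus_cell R) dx P z = 0.
Proof.
move=> hP cP pP; rewrite /Rintegral integral_torus_patch//.
rewrite -integral21_prod_meas1; last exact: integrable_patch_torus.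
rewrite integral0_eq// => y _; rewrite /fubini_G.
under eq_integral do rewrite patchE in_setX /=.
have [yI|yI] := boolP (y \in (`[0%R, 1%R]%classic : set R)); last first.
  by apply: integral0_eq => x _; rewrite andbF.
transitivity (\int[mu]_x ((fun x => (dx P (x, y))%:E) \_ `[0%R, 1%R]) x)%E.
  by apply: eq_integral => x _; rewrite patchE andbT.
rewrite -integral_mkcond (@FTC2_derivable _ (fun s => P (s, y)))//.
- by rewrite -[X in P (X, y)]add0r (pP 0 y).1 subrr.
- by move=> s; exact: (hP (s, y)).1.
- exact: continuous_slice1 cP.
Qed.

Lemma integral_torus_dy (P : R * R -> R) : has_partials P ->
  continuous (dy P) -> periodic2 P ->
  \int[lebesgue2 R]_(z in torus_cell R) dy P z = 0.
Proof.
move=> hP cP pP; rewrite /Rintegral integral_torus_patch//.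
rewrite -integral12_prod_meas1; last exact: integrable_patch_torus.
rewrite integral0_eq// => x _; rewrite /fubini_F.
under eq_integral do rewrite patchE in_setX /=.
have [xI|xI] := boolP (x \in (`[0%R, 1%R]%classic : set R)); last first.
  exact: integral0_eq.
transitivity (\int[mu]_y ((fun y => (dy P (x, y))%:E) \_ `[0%R, 1%R]) y)%E.
  by apply: eq_integral => y _; rewrite patchE.
rewrite -integral_mkcond (@FTC2_derivable _ (fun s => P (x, s)))//.
- by rewrite -[X in P (x, X)]add0r (pP x 0).2 subrr.
- by move=> s; exact: (hP (x, s)).2.
- exact: continuous_slice2 cP.
Qed.

Lemma has_partialsM a h : has_partials a -> has_partials h ->
  has_partials (fun z => a z * h z).
Proof.
by move=> ha hh z; split; apply: derivableM;
  [exact: (ha z).1|exact: (hh z).1|exact: (ha z).2|exact: (hh z).2].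
Qed.

Lemma dxM a h : has_partials a -> has_partials h ->
  dx (fun z => a z * h z) = (fun z => a z * dx h z + h z * dx a z).
Proof.
move=> ha hh; apply/funext => z; rewrite /dx !derive1E.
by rewrite (deriveM (ha z).1 (hh z).1) -surjective_pairing.
Qed.

Lemma dyM a h : has_partials a -> has_partials h ->
  dy (fun z => a z * h z) = (fun z => a z * dy h z + h z * dy a z).
Proof.
move=> ha hh; apply/funext => z; rewrite /dy !derive1E.
by rewrite (deriveM (ha z).2 (hh z).2) -surjective_pairing.
Qed.

Lemma derive1_periodic (f : R -> R) x : (forall s, f (s + 1) = f s) ->
  derive1 f (x + 1) = derive1 f x.
Proof. by move=> pf; rewrite /derive1; under eq_fun do rewrite addrA !pf. Qed.

Lemma periodic2_dx a : periodic2 a -> periodic2 (dx a).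
Proof.
move=> pa x y; split; first by apply: derive1_periodic => s; rewrite (pa s y).1.
by rewrite /dx /=; congr derive1; apply/funext => s; rewrite (pa s y).2.
Qed.

Lemma periodic2_dy a : periodic2 a -> periodic2 (dy a).
Proof.
move=> pa x y; split; last by apply: derive1_periodic => s; rewrite (pa x s).2.
by rewrite /dy /=; congr derive1; apply/funext => s; rewrite (pa x s).1.
Qed.

Lemma continuousM2 a h : continuous a -> continuous h ->
  continuous (fun z => a z * h z).
Proof. by move=> ca ch z; apply: continuousM; [exact: ca|exact: ch]. Qed.

Lemma continuousD2 a h : continuous a -> continuous h ->
  continuous (fun z => a z + h z).
Proof. by move=> ca ch z; apply: continuousD; [exact: ca|exact: ch]. Qed.

Lemma continuousB2 a h : continuous a -> continuous h ->
  continuous (fun z => a z - h z).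
Proof. by move=> ca ch z; apply: continuousB; [exact: ca|exact: ch]. Qed.

Lemma advect_velocityE psi h : advect (velocity psi) h =
  (fun z => dy psi z * dx h z - dx psi z * dy h z).
Proof.
by apply/funext => z; rewrite /advect /velocity /= opprK mulNr.
Qed.

Lemma continuous_advect_velocity psi h : C1_space psi -> C1_space h ->
  continuous (advect (velocity psi) h).
Proof.
move=> [_ _ cpx cpy] [_ _ chx chy]; rewrite advect_velocityE.
by apply: continuousB2; apply: continuousM2.
Qed.

(* [velocity psi] is divergence free by Clairaut's theorem, so that
   [advect (velocity psi) h] is itself a divergence. *)
Lemma integral_advect_velocity psi h : periodic2 psi -> C2_space psi ->
  periodic2 h -> C1_space h ->
  \int[lebesgue2 R]_(z in torus_cell R) advect (velocity psi) h z = 0.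
Proof.
move=> ppsi C2 ph [ch hh cdxh cdyh].
have [_ [cdx hdx _ cdydx] [cdy hdy cdxdy _]] := C2.
have cdyM : continuous (dx (fun z => dy psi z * h z)).
  by rewrite dxM//; apply: continuousD2; exact: continuousM2.
have cdxM : continuous (dy (fun z => dx psi z * h z)).
  by rewrite dyM//; apply: continuousD2; exact: continuousM2.
have -> : advect (velocity psi) h = (fun z =>
    dx (fun z => dy psi z * h z) z - dy (fun z => dx psi z * h z) z).
  apply/funext => z; rewrite dxM// dyM// (clairaut C2) advect_velocityE; ring.
rewrite RintegralB; [|exact: measurable_torus_cell
  |exact: continuous_integrable_torus..].
have pM a : periodic2 a -> periodic2 (fun z => a z * h z).
  by move=> pa x y; rewrite (pa x y).1 (pa x y).2 (ph x y).1 (ph x y).2.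
rewrite -[RHS](subrr 0); congr (_ - _).
- apply: integral_torus_dx; [exact: has_partialsM|exact: cdyM|].
  exact/pM/periodic2_dy.
- apply: integral_torus_dy; [exact: has_partialsM|exact: cdxM|].
  exact/pM/periodic2_dx.
Qed.

End Divergence.

(** * The lifespan and the continuity of a regular vorticity in time and space *)

Section Transport.
Context {R : realType}.
Variables (T : \bar R) (a psi : R -> R * R -> R).
Hypothesis a_regular : vorticity_regular T a.

Lemma open_lifespan_itv (t : R) : open_lifespan T t ->
  exists u v : R, [/\ 0 < u, u < t < v &
    forall s, s \in `[u, v] -> open_lifespan T s].
Proof.
move=> [t0 tT].
have [v tv vT] : exists2 v : R, t < v & (v%:E < T)%E.
  (* The right end is the midpoint of [t] and a finite [T], or [t + 1] when [T] is infinite. *)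
  case: T tT => [r||]//; last by exists (t + 1); rewrite ?ltrDl// ltry.
  by rewrite lte_fin => tr; exists ((t + r) / 2); rewrite ?midf_lt// lte_fin midf_lt.
exists (t / 2), v; split; first by rewrite divr_gt0.
  by rewrite tv ltr_pdivrMr// mulr_natr mulr2n ltrDl t0.
move=> s; rewrite in_itv/= => /andP[ts sv]; split.
  by apply: lt_le_trans ts; rewrite divr_gt0.
by apply: le_lt_trans vT; rewrite lee_fin.
Qed.

Lemma open_lifespanW (t : R) : open_lifespan T t -> lifespan T t.
Proof. by move=> [t0 tT]; split; [exact: ltW|]. Qed.

Lemma open_lifespan_near (t : R) : open_lifespan T t ->
  \forall s \near t, open_lifespan T s.
Proof.
move=> /open_lifespan_itv[u [v [_ tuv uvT]]].
have /near_in_itvoo : t \in `]u, v[ by rewrite in_itv.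
by apply: filterS => s suv; apply: uvT; exact: subset_itv_oo_cc.
Qed.

Lemma regular_within (p : R * (R * R)) : lifespan T p.1 ->
  a q.1 q.2 @[q --> within (lifespan T `*` setT) (nbhs p)] --> a p.1 p.2.
Proof.
by move=> pT; move/subspace_continuousP: (vr_continuous a_regular); apply.
Qed.

(** At an interior time the lifespan is a neighbourhood, so continuity within it is plain
    continuity. *)
Lemma regular_continuous_cylinder (p : R * (R * R)) : open_lifespan T p.1 ->
  {for p, continuous (fun q : R * (R * R) => a q.1 q.2)}.
Proof.
move=> pT; have := regular_within (open_lifespanW pT).
rewrite within_interior//; have := open_lifespan_near pT.
move=> nT; rewrite /interior; near=> q; split => //.
apply: open_lifespanW; near: q.
by case: p pT nT => t z /= pT nT; apply: (cvg_fst nT).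
Unshelve. all: end_near. Qed.

(** This serves at the initial time, where [a] is continuous only from within the lifespan; hence
    the requirement that [h] stay in it. *)
Lemma regular_cvg_slice (t : R) (X : Type) (F : set_system X) (h : X -> R) z :
  Filter F -> lifespan T t -> (forall x, lifespan T (h x)) ->
  h x @[x --> F] --> t -> a (h x) z @[x --> F] --> a t z.
Proof.
move=> FF tT hT ht; apply: cvg_trans (regular_within (p := (t, z)) tT).
move=> U /= [[A B] /= [At Bz] ABU].
have : \forall x \near F, A (h x) by exact: ht.
apply: filterS => x Ahx; apply: (ABU (h x, z)); split => //=.
exact: nbhs_singleton Bz.
Qed.

Lemma regular_continuous (t : R) : lifespan T t -> continuous (a t).
Proof.
move=> tT z; apply: cvg_trans (regular_within (p := (t, z)) tT).
move=> U /= [[A B] /= [At Bz] ABU].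
apply: filterS Bz => w Bw; apply: (ABU (t, w)); split => //=.
exact: nbhs_singleton At.
Qed.

Lemma continuous_cylinder_slice (F : R * (R * R) -> R) (t : R) :
  (forall z, {for (t, z), continuous F}) -> continuous (fun z => F (t, z)).
Proof.
move=> cF z; apply: (@continuous_comp _ _ _ (fun z => (t, z)) F); last exact: cF.
exact: (@cvg_pair _ _ _ (nbhs z) (nbhs t) (nbhs z) _ _ _ (cst t) id (cvg_cst t)
  cvg_id).
Qed.

Lemma regular_C1_space (t : R) : open_lifespan T t -> C1_space (a t).
Proof.
move=> tT; split.
- exact/regular_continuous/open_lifespanW.
- exact: (vr_partials a_regular tT).
- apply: (@continuous_cylinder_slice (fun q => dx (a q.1) q.2) t) => z.
  exact: (vr_continuous_dx a_regular (p := (t, z)) tT).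
- apply: (@continuous_cylinder_slice (fun q => dy (a q.1) q.2) t) => z.
  exact: (vr_continuous_dy a_regular (p := (t, z)) tT).
Qed.

End Transport.

(** * Chain rules for a C^1 function of a scalar field *)

Section Chain.
Context {R : realType}.

Lemma is_derive1_derive1 (f : R -> R) x : derivable f x 1 ->
  is_derive x 1 f (derive1 f x).
Proof. by move=> df; rewrite derive1E; exact/derivableP. Qed.

Variables (f : R -> R).
Hypotheses (df : forall x, derivable f x 1) (cf' : continuous (derive1 f)).

Lemma derivable_continuous x : {for x, continuous f}.
Proof. exact/differentiable_continuous/derivable1_diffP. Qed.

Lemma is_derive1_chain (g : R -> R) x : derivable g x 1 ->
  is_derive x 1 (f \o g) (derive1 f (g x) * derive1 g x).
Proof.
move=> dg.
exact: (@is_derive1_comp R f g x _ _ (is_derive1_derive1 (@df (g x)))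
  (is_derive1_derive1 dg)).
Qed.

Lemma derive1_chain (g : R -> R) x : derivable g x 1 ->
  derive1 (f \o g) x = derive1 f (g x) * derive1 g x.
Proof.
by move=> dg; rewrite derive1E; have := is_derive1_chain dg => ?; exact: derive_val.
Qed.

Variable h : R * R -> R.

Lemma dx_chain : has_partials h ->
  dx (f \o h) = (fun z => derive1 f (h z) * dx h z).
Proof.
move=> hh; apply/funext => z.
rewrite /dx (derive1_chain (g := fun s => h (s, z.2)) (hh z).1).
by rewrite -surjective_pairing.
Qed.

Lemma dy_chain : has_partials h ->
  dy (f \o h) = (fun z => derive1 f (h z) * dy h z).
Proof.
move=> hh; apply/funext => z.
rewrite /dy (derive1_chain (g := fun s => h (z.1, s)) (hh z).2).
by rewrite -surjective_pairing.
Qed.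

Lemma C1_space_comp : C1_space h -> C1_space (f \o h).
Proof.
move=> [ch hh cdx cdy].
have cf'h : continuous (fun z => derive1 f (h z)).
  by move=> z; apply: (@continuous_comp _ _ _ h (derive1 f));
    [exact: ch|exact: cf'].
split.
- by move=> z; apply: (@continuous_comp _ _ _ h f);
    [exact: ch|exact: derivable_continuous].
- by move=> z; split;
    [exact: (ex_derive (is_derive := is_derive1_chain (hh z).1))
    |exact: (ex_derive (is_derive := is_derive1_chain (hh z).2))].
- by rewrite dx_chain//; exact: continuousM2.
- by rewrite dy_chain//; exact: continuousM2.
Qed.

(** Together with the chain rule in time, this shows that a C^1 function of a transported scalar is
    transported by the same field. *)
Lemma advect_chain (u : R * R -> R * R) z : has_partials h ->
  advect u (f \o h) z = derive1 f (h z) * advect u h z.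
Proof.
move=> hh; rewrite /advect dx_chain// dy_chain//.
by move: (dx h z) (dy h z) => p q; ring.
Qed.

End Chain.

(** * Conservation of the integral of a C^1 observable *)

Section Conservation.
Context {R : realType}.
Variables (T : \bar R) (a psi : R -> R * R -> R).
Hypothesis a_regular : vorticity_regular T a.
Hypothesis psi_C2 : forall t, lifespan T t -> periodic2 (psi t) /\ C2_space (psi t).
Hypothesis a_transport : forall t z, open_lifespan T t ->
  dt a t z + advect (velocity (psi t)) (a t) z = 0.

Section smooth_observable.
Variable f : R -> R.
Hypotheses (df : forall x, derivable f x 1) (cf' : continuous (derive1 f)).

Let F t := \int[lebesgue2 R]_(z in torus_cell R) f (a t z).
(** At interior times, this is the time derivative of the integrand of [F]. *)
Let g (p : R * (R * R)) := derive1 f (a p.1 p.2) * dt a p.1 p.2.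

Lemma observable_continuous t : lifespan T t -> continuous (fun z => f (a t z)).
Proof.
move=> tT z; apply: (@continuous_comp _ _ _ (a t) f).
  exact: (regular_continuous a_regular tT).
exact: (derivable_continuous (@df)).
Qed.

(** The continuous function [|g|] attains a maximum on the compact set [[u, v]] times the cell. The
    bound dominates the time derivative when differentiating under the integral. *)
Lemma observable_dt_bounded (u v : R) : u < v ->
  (forall s, s \in `[u, v] -> open_lifespan T s) ->
  exists M, forall s z, s \in `[u, v] -> torus_cell R z -> `|g (s, z)| <= M.
Proof.
move=> uv uvT.
have cg p : open_lifespan T p.1 -> {for p, continuous (fun q => `|g q|)}.
  move=> pT; apply: (@continuous_comp _ _ _ g Num.norm);
    last exact: norm_continuous.
  apply: continuousM; last exact: (vr_continuous_dt a_regular).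
  apply: (@continuous_comp _ _ _ (fun q : R * (R * R) => a q.1 q.2));
    last exact: cf'.
  exact: (regular_continuous_cylinder a_regular).
pose K : set (R * (R * R)) := `[u, v] `*` torus_cell R.
have K0 : K !=set0.
  exists (u, (0, 0)); split; first by rewrite /= in_itv/= lexx ltW.
  by split; rewrite /= in_itv/= lexx ler01.
have cK : compact K.
  by apply: compact_setX; [exact: segment_compact|exact: compact_torus_cell].
have wcg : {within K, continuous (fun q => `|g q|)}.
  apply/subspace_continuousP => p [pu _]; apply: cvg_within_filter.
  exact/cg/uvT.
have [p _ pmax] := compact_EVT_max K0 cK wcg.
by exists `|g p| => s z suv zc; apply: (pmax (s, z)); rewrite inE.
Qed.

(** Differentiation under the integral gives the integral of the time derivative of [f(a)], which by
    transport is minus the advection of [f(a)] by a divergence-free field. *)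
Lemma observable_is_derive0 (t : R) : open_lifespan T t -> is_derive t 1 F 0.
Proof.
move=> tT; have [u [v [_ tuv uvT]]] := open_lifespan_itv tT.
have uv : u < v by move: tuv => /andP[+ +]; exact: lt_trans.
have [M gM] := observable_dt_bounded uv uvT.
have sub s : `]u, v[%classic s -> s \in `[u, v] by exact: subset_itv_oo_cc.
have Ft s : `]u, v[%classic s ->
    (lebesgue2 R).-integrable (torus_cell R) (EFin \o (fun z => f (a s z))).
  move=> /sub/uvT/open_lifespanW sT.
  exact: continuous_integrable_torus (observable_continuous sT).
have dft s z : `]u, v[%classic s -> torus_cell R z ->
    derivable (fun s => f (a s z)) s 1.
  move=> /sub/uvT sT _.
  have dz := @is_derive1_chain R f (@df) (fun s => a s z) s
    (@vr_derivable_t _ _ _ a_regular s z sT).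
  exact: (@ex_derive _ _ _ _ _ _ _ dz).
have dE s z : open_lifespan T s ->
    partial1of2 (fun s z => f (a s z)) s z = g (s, z).
  move=> sT; exact: (@derive1_chain R f (@df) (fun s => a s z) s
    (@vr_derivable_t _ _ _ a_regular s z sT)).
have It : `]u, v[%classic t by rewrite /= in_itv.
(* [M] bounds an absolute value at a point of the cell. *)
have M0 : 0 <= M.
  apply: le_trans (gM t (0, 0) (sub _ It) _) => //.
  by split; rewrite /= in_itv/= lexx ler01.
have intM : (lebesgue2 R).-integrable (torus_cell R) (EFin \o (fun=> M)).
  by apply: continuous_integrable_torus => z; exact: cvg_cst.
have G_ub s z : `]u, v[%classic s -> torus_cell R z ->
    `|partial1of2 (fun s z => f (a s z)) s z| <= M.
  move=> suv zc; rewrite dE; first by apply: gM => //; exact: sub.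
  exact/uvT/sub.
have dF := derivable_under_integral measurable_torus_cell It Ft dft
  (fun=> M0) intM G_ub.
have := differentiation_under_integral measurable_torus_cell It Ft dft
  (fun=> M0) intM G_ub.
rewrite (_ : \int[_]_(y in _) _ = 0); last first.
  have [ppsi C2] := psi_C2 (open_lifespanW tT).
  have C1a := regular_C1_space a_regular tT.
  have C1 := C1_space_comp (@df) (@cf') C1a.
  have pa : periodic2 (f \o a t).
    move=> x y; have [px py] := vr_periodic a_regular (open_lifespanW tT) x y.
    by rewrite /= px py.
  transitivity (\int[lebesgue2 R]_(z in torus_cell R)
      (-1 * advect (velocity (psi t)) (f \o a t) z)).
    apply: eq_Rintegral => z _; rewrite dE//.
    rewrite (advect_chain (@df) _ _ (vr_partials a_regular tT)).
    rewrite mulN1r -mulrN; congr (_ * _).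
    by apply/eqP; rewrite -addr_eq0 a_transport.
  rewrite RintegralZl; last 2 first.
  - exact: measurable_torus_cell.
  - apply: continuous_integrable_torus.
    by case: C2 => C1psi _ _; exact: continuous_advect_velocity C1psi C1.
  by rewrite integral_advect_velocity// mulr0.
move=> F'0; apply: (DeriveDef dF); rewrite -derive1E; exact: F'0.
Qed.

Lemma observable_conserved_open (s t : R) : open_lifespan T s ->
  open_lifespan T t -> F s = F t.
Proof.
wlog st : s t / s < t.
  move=> wl sT tT; have [st|ts|->//] := ltgtP s t; first exact: wl.
  by apply/esym; exact: wl.
move=> [s0 _] [_ tT].
have mid x : x \in `[s, t] -> open_lifespan T x.
  rewrite in_itv/= => /andP[sx xt]; split; first exact: lt_le_trans sx.
  by apply: le_lt_trans tT; rewrite lee_fin.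
(* The derivative of [F] is zero on [[s, t]], so the mean value theorem gives [F t - F s = 0]. *)
have [c _] := @MVT R F (fun=> 0) s t st
  (fun x xst => observable_is_derive0 (mid x (subset_itv_oo_cc xst)))
  (derivable_within_continuous (fun x xst =>
    ex_derive (is_derive := observable_is_derive0 (mid x xst)))).
by rewrite mul0r => /eqP; rewrite subr_eq0 => /eqP.
Qed.

Lemma integral_observableE (t : R) : lifespan T t ->
  (\int[lebesgue2 R]_(z in torus_cell R) (f (a t z))%:E = (F t)%:E)%E.
Proof.
move=> tT; rewrite /F /Rintegral fineK//; apply: integrable_fin_num.
  exact: measurable_torus_cell.
exact: continuous_integrable_torus (observable_continuous tT).
Qed.

(** The equation holds only at positive times, so time 0 is reached as a limit: the bound on [f] and
    the finite measure of the cell allow dominated convergence. *)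
Lemma observable_conserved (M : R) (t : R) : (forall x, `|f x| <= M) ->
  lifespan T t ->
  (\int[lebesgue2 R]_(z in torus_cell R) (f (a t z))%:E =
   \int[lebesgue2 R]_(z in torus_cell R) (f (a 0 z))%:E)%E.
Proof.
move=> fM Tt; have [->//|tneq0] := eqVneq t 0.
have [t0 tT] := Tt.
have {}t0 : 0 < t by rewrite lt_neqAle eq_sym tneq0.
have T0 : lifespan T 0 by split => //; apply: le_lt_trans tT; rewrite lee_fin ltW.
(* These times lie in [(0, t]], hence in the open lifespan, and tend to 0. *)
pose tn n := t * n.+1%:R^-1 : R.
have tnT n : open_lifespan T (tn n).
  split; first by rewrite mulr_gt0// invr_gt0.
  apply: le_lt_trans tT; rewrite lee_fin ler_piMr//; first exact: ltW.
  by rewrite invf_le1// ler1n.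
have tn0 : tn n @[n --> \oo] --> 0.
  rewrite -[X in _ --> X](mulr0 t).
  by apply: cvgM; [exact: cvg_cst|exact: cvg_harmonic].
have mf s : lifespan T s ->
    measurable_fun (torus_cell R) (fun z => (f (a s z))%:E).
  move=> sT; apply/measurable_EFinP; apply: measurable_funTS.
  exact: continuous_measurable2 (observable_continuous sT).
have tnW n := open_lifespanW (tnT n).
have fcvg z : (f (a (tn n) z))%:E @[n --> \oo] --> (f (a 0 z))%:E.
  apply/fine_cvgP; split; first by apply: nearW => n.
  apply: (@continuous_cvg nat R R \oo _ (fun n => a (tn n) z) f (a 0 z)).
    exact: (derivable_continuous (@df)).
  exact: (@regular_cvg_slice _ _ _ a_regular 0 _ _ tn z _ T0 tnW tn0).
have intM : (lebesgue2 R).-integrable (torus_cell R) (EFin \o (fun=> M)).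
  by apply: continuous_integrable_torus => z; exact: cvg_cst.
have [_ _] := @dominated_convergence _ _ _ (lebesgue2 R) _ measurable_torus_cell
  (fun n z => (f (a (tn n) z))%:E) (fun z => (f (a 0 z))%:E) (EFin \o (fun=> M))
  (fun n => mf _ (tnW n)) (mf _ T0) (aeW _ (fun z _ => fcvg z)) intM
  (aeW _ (fun z n _ => fM _)).
(* By conservation at positive times the sequence of integrals is constant. *)
have -> : (fun n => \int[lebesgue2 R]_(z in torus_cell R) (f (a (tn n) z))%:E)%E =
    (fun=> \int[lebesgue2 R]_(z in torus_cell R) (f (a t z))%:E)%E.
  apply/funext => n; rewrite (integral_observableE (tnW n)).
  rewrite (integral_observableE Tt); congr EFin.
  by apply: observable_conserved_open.
by move=> /(cvg_lim (@ereal_hausdorff R)) <-; rewrite lim_cst.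
Qed.

End smooth_observable.
End Conservation.

(** * Equimeasurable functions have the same law, hence the same integrals *)

Section Law.
Context {R : realType}.
Implicit Types a b : R * R -> R.
(** The law of a function on the torus is its pushforward of this finite measure. *)
Let cellmu := mrestr (lebesgue2 R) (@measurable_torus_cell R).

(** The two laws agree on the half-lines []s, +oo[], which are stable under intersection and
    generate the Borel sets, so they agree everywhere by uniqueness of measures. *)
Lemma equimeasurable_preimage a b : measurable_fun setT a ->
  measurable_fun setT b -> equimeasurable a b ->
  forall B, measurable B ->
    lebesgue2 R (a @^-1` B `&` torus_cell R) =
    lebesgue2 R (b @^-1` B `&` torus_cell R).
Proof.
move=> ma mb ab B mB.
(* Uniqueness of measures asks for generators of finite measure that exhaust the line. *)
pose g k : set R := `]- k%:R, +oo[%classic.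
have gT : \bigcup_k g k = setT.
  apply/seteqP; split => // x _; exists (Num.bound `|x|) => //.
  rewrite /g /= in_itv/= andbT ltrNl.
  apply: le_lt_trans (archi_boundP (normr_ge0 x)).
  by rewrite -normrN ler_norm.
have GI : setI_closed (@RGenOInfty.G R).
  move=> _ _ [s ->] [t ->]; exists (Num.max s t).
  by apply/seteqP; split => x /=; rewrite !in_itv/= !andbT gt_max => /andP.
have eqG A : RGenOInfty.G A -> cellmu (a @^-1` A) = cellmu (b @^-1` A).
  move=> [s ->]; rewrite /cellmu /mrestr ![_ `&` torus_cell R]setIC set_itvE.
  exact: ab.
have cellmu_fin A : measurable A -> (cellmu A < +oo)%E.
  move=> mA; apply: (@le_lt_trans _ _ (lebesgue2 R (torus_cell R))).
    exact: (@measureIr _ _ _ (lebesgue2 R) _ _ mA (@measurable_torus_cell R)).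
  by rewrite lebesgue2_torus_cell ltry.
have mag k : measurable (a @^-1` g k).
  rewrite -[X in measurable X]setTI.
  by apply: ma => //; exact: measurable_itv.
exact: (@measure_unique _ _ _ (@RGenOInfty.G R) g
  (RGenOInfty.measurableE R) GI (fun k => ex_intro _ _ erefl) gT
  (measure_function_pushforward__canonical__measure_function_Measure cellmu ma)
  (measure_function_pushforward__canonical__measure_function_Measure cellmu mb)
  eqG (fun k => cellmu_fin _ (mag k)) B mB).
Qed.

(** The complement of the cell is null for [cellmu], and the two measures agree on subsets of the
    cell. *)
Lemma ge0_integral_cellmu (g : R * R -> \bar R) : measurable_fun setT g ->
  (forall z, 0 <= g z)%E ->
  (\int[cellmu]_z g z = \int[lebesgue2 R]_(z in torus_cell R) g z)%E.
Proof.
move=> mg g0; have mcell := @measurable_torus_cell R.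
have outside : cellmu (~` torus_cell R) = 0%E.
  by rewrite /cellmu /mrestr setICl; exact: (measure0 (lebesgue2 R)).
apply: etrans (@ge0_negligible_integral _ _ _ cellmu _ _ _ (measurableC mcell)
  measurableT mg (fun z _ => g0 z) outside) _.
rewrite setTD setCK.
apply: (@eq_measure_integral _ _ _ _ (lebesgue2 R) cellmu) => A _ Acell.
by rewrite -[LHS]/(lebesgue2 R (A `&` torus_cell R)) setIidl.
Qed.

(** By change of variables, each side is the integral of [f] against the law of [a] or [b]. *)
Lemma ge0_integral_equimeasurable a b (f : R -> \bar R) :
  measurable_fun setT a -> measurable_fun setT b -> equimeasurable a b ->
  measurable_fun setT f -> (forall x, 0 <= f x)%E ->
  (\int[lebesgue2 R]_(z in torus_cell R) f (a z) =
   \int[lebesgue2 R]_(z in torus_cell R) f (b z))%E.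
Proof.
move=> ma mb ab mf f0.
have push c (mc : measurable_fun setT c) :
    (\int[lebesgue2 R]_(z in torus_cell R) f (c z) =
     \int[pushforward cellmu c]_y f y)%E.
  apply: etrans (esym (ge0_integral_cellmu (measurableT_comp mf mc)
    (fun z => f0 (c z)))) _.
  exact: esym (@ge0_integral_pushforward _ _ _ _ _ _ mc cellmu _ _
    measurableT mf (fun y _ => f0 y)).
apply: etrans (push a ma) _; apply: etrans _ (esym (push b mb)).
apply: (@eq_measure_integral _ _ _ _
  (measure_function_pushforward__canonical__measure_function_Measure cellmu mb)
  (measure_function_pushforward__canonical__measure_function_Measure cellmu ma)).
by move=> A mA _; exact: equimeasurable_preimage.
Qed.

Lemma integral_equimeasurable a b (f : R -> R) :
  measurable_fun setT a -> measurable_fun setT b -> equimeasurable a b ->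
  measurable_fun setT f ->
  \int[lebesgue2 R]_(z in torus_cell R) f (a z) =
  \int[lebesgue2 R]_(z in torus_cell R) f (b z).
Proof.
move=> ma mb ab mf; rewrite /Rintegral; congr fine.
have mf' : measurable_fun setT (EFin \o f) by exact/measurable_EFinP.
have split_parts (c : R * R -> R) :
    (\int[lebesgue2 R]_(z in torus_cell R) ((EFin \o f) \o c) z =
     \int[lebesgue2 R]_(z in torus_cell R) (EFin \o f)^\+ (c z) -
     \int[lebesgue2 R]_(z in torus_cell R) (EFin \o f)^\- (c z))%E.
  by rewrite integralE funepos_comp funeneg_comp.
apply: etrans (split_parts a) _; apply: etrans _ (esym (split_parts b)).
congr (_ - _)%E.
- exact: (ge0_integral_equimeasurable ma mb ab (measurable_funepos mf')
    (funepos_ge0 (EFin \o f))).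
- exact: (ge0_integral_equimeasurable ma mb ab (measurable_funeneg mf')
    (funeneg_ge0 (EFin \o f))).
Qed.

Lemma integrable_equimeasurable a b (f : R -> R) :
  measurable_fun setT a -> measurable_fun setT b -> equimeasurable a b ->
  measurable_fun setT f ->
  integrable_torus (f \o a) -> integrable_torus (f \o b).
Proof.
move=> ma mb ab mf /integrableP[_ fa]; apply/integrableP; split.
  by apply/measurable_EFinP/measurable_funTS; exact: measurableT_comp.
have mf' : measurable_fun setT (fun x => `|(f x)%:E|%E).
  by apply: measurableT_comp => //; exact/measurable_EFinP.
apply: le_lt_trans fa; rewrite le_eqVlt; apply/orP; left; apply/eqP/esym.
exact: (ge0_integral_equimeasurable ma mb ab mf' (fun x => abse_ge0 (f x)%:E)).
Qed.

End Law.

(** * Approximation of the indicator of a half-line by C^1 functions *)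

Section Step.
Context {R : realType}.

(* a C^1 function of [v] that increases to the indicator of [s < v] with [n] *)
Definition soft_step (s : R) (n : nat) (v : R) : R :=
  1 - expR (- (n%:R * Num.max (v - s) 0 ^+ 2)).

(** Squaring removes the kink of the positive part: the difference quotient with increment [k] is
    within [|k|] of the claimed derivative. *)
Lemma is_derive_sqr_pospart (s x : R) :
  is_derive x 1 (fun v => Num.max (v - s) 0 ^+ 2) (2 * Num.max (x - s) 0).
Proof.
have quot : (fun k : R => k^-1 *: (((fun v => Num.max (v - s) 0 ^+ 2) \o shift x)
    (k *: 1) - Num.max (x - s) 0 ^+ 2)) @ 0^' --> 2 * Num.max (x - s) 0.
  apply/cvgrPdist_le => e e0; near=> k.
  have k0 : k != 0 by near: k; exact: nbhs_dnbhs_neq.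
  have ke : `|k| <= e by near: k; exact: dnbhs0_le.
  (* Multiplied by [|k|], the claim is a polynomial inequality with right side [k ^+ 2], checked
     according to the signs of [x + k - s] and [x - s]. *)
  apply: le_trans ke; rewrite -(ler_pM2r (x := `|k|)) ?normr_gt0//.
  rewrite -[leLHS]normrM mulrBl /GRing.scale/= mulr1.
  rewrite [k^-1 * _]mulrC mulfVK// -normrM -expr2.
  rewrite [leRHS]ger0_norm ?sqr_ge0// ler_norml.
  rewrite /Num.max /Order.max; case: ltP => h1; case: ltP => h2; nra.
apply: DeriveDef; first by apply/cvg_ex; eexists; exact: quot.
exact: (cvg_lim (@Rhausdorff R) quot).
Unshelve. all: end_near. Qed.

Lemma is_derive_soft_step (s : R) n (x : R) :
  is_derive x 1 (soft_step s n) (expR (- (n%:R * Num.max (x - s) 0 ^+ 2)) *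
    (n%:R * (2 * Num.max (x - s) 0))).
Proof.
have p' := is_derive_sqr_pospart s x.
have e' := @is_derive1_comp R expR
  (fun v => - (n%:R * Num.max (v - s) 0 ^+ 2)) x _ _
  (is_derive_expR _) (is_deriveN (is_deriveZ n%:R p')).
(* The derivative takes the form [0 - expR _ * - _] that the rules for differences and compositions
   produce. *)
rewrite -[X in is_derive _ _ _ X]opprK -mulrN -[- (_ * _)]add0r.
exact: is_deriveB (is_derive_cst _ _ _) e'.
Qed.

Lemma derivable_soft_step s n x : derivable (soft_step s n) x 1.
Proof. exact: (ex_derive (is_derive := is_derive_soft_step s n x)). Qed.

Lemma continuous_derive1_soft_step s n : continuous (derive1 (soft_step s n)).
Proof.
have -> : derive1 (soft_step s n) = (fun x =>
    expR (- (n%:R * Num.max (x - s) 0 ^+ 2)) * (n%:R * (2 * Num.max (x - s) 0))).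
  apply/funext => x; rewrite derive1E.
  by have h := is_derive_soft_step s n x; exact: derive_val.
have cmax : continuous (fun x : R => Num.max (x - s) 0).
  move=> x; apply: (@continuous_max R R (fun x => x - s) (fun=> 0) x);
    last exact: cvg_cst.
  by apply: continuousB; [exact: cvg_id|exact: cvg_cst].
move=> x; apply: cvgM.
  apply: (@continuous_comp _ _ _ (fun x => - (n%:R * Num.max (x - s) 0 ^+ 2))
    expR); last exact: continuous_expR.
  apply: cvgN; apply: cvgM; first exact: cvg_cst.
  by rewrite expr2; under eq_fun do rewrite expr2; apply: cvgM; exact: cmax.
apply: cvgM; first exact: cvg_cst.
by apply: cvgM; [exact: cvg_cst|exact: cmax].
Qed.

Lemma soft_step_le1 s n x : `|soft_step s n x| <= 1.
Proof.
rewrite ger0_norm /soft_step ?gerBl ?expR_ge0// subr_ge0 expR_le1.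
by rewrite oppr_le0 mulr_ge0// sqr_ge0.
Qed.

(** For [s < x] the exponential is a geometric sequence of ratio less than 1; for [x <= s] the step
    is 0 for every [n]. *)
Lemma soft_step_cvg s x : soft_step s n x @[n --> \oo] --> (\1_[set v | s < v] x : R).
Proof.
rewrite indicE; have [sx|xs] := ltP s x.
  rewrite mem_set//= -[X in _ --> X](subr0 1); apply: cvgB; first exact: cvg_cst.
  have c0 : 0 < Num.max (x - s) 0 ^+ 2 by rewrite exprn_gt0// lt_max subr_gt0 sx.
  under eq_fun do rewrite -mulrN expRM_natl.
  by apply: cvg_expr; rewrite ger0_norm ?expR_ge0// expR_lt1 oppr_lt0.
rewrite memNset/=; last by rewrite ltNge xs.
have x0 : Num.max (x - s) 0 = 0 by apply/max_idPr; rewrite subr_le0.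
rewrite /soft_step x0 expr0n/=; under eq_fun do rewrite mulr0 oppr0 expR0 subrr.
exact: cvg_cst.
Qed.

Lemma cvg_integral_soft_step (a : R * R -> R) s : continuous a ->
  (\int[lebesgue2 R]_(z in torus_cell R) (soft_step s n (a z))%:E)%E
    @[n --> \oo] --> lebesgue2 R (torus_cell R `&` [set z | s < a z]).
Proof.
move=> ca; pose U := [set z | s < a z].
have mU : measurable U.
  have := continuous_measurable2 ca measurableT (open_measurable (@open_gt R s)).
  by rewrite setTI.
have cstep n : continuous (fun z => soft_step s n (a z)).
  move=> z; apply: (@continuous_comp _ _ _ a (soft_step s n)); first exact: ca.
  exact: (derivable_continuous (@derivable_soft_step s n)).
rewrite setIC -(@integral_indic _ _ _ (lebesgue2 R) _ (@measurable_torus_cell R) U mU).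
have int1 : (lebesgue2 R).-integrable (torus_cell R) (EFin \o (fun=> 1)).
  by apply: continuous_integrable_torus => z; exact: cvg_cst.
have fcvg z : (soft_step s n (a z))%:E @[n --> \oo] --> (\1_U z : R)%:E.
  apply/fine_cvgP; split; first by apply: nearW.
  exact: soft_step_cvg.
have mstep n : measurable_fun (torus_cell R) (fun z => (soft_step s n (a z))%:E).
  apply/measurable_EFinP/measurable_funTS.
  exact: continuous_measurable2 (cstep n).
have mindic : measurable_fun (torus_cell R) (fun z => (\1_U z : R)%:E).
  by apply/measurable_EFinP; exact: measurable_indic.
by have [] := @dominated_convergence _ _ _ (lebesgue2 R) _ (@measurable_torus_cell R)
  (fun n z => (soft_step s n (a z))%:E) (fun z => (\1_U z)%:E)
  (EFin \o (fun=> 1)) mstep mindic (aeW _ (fun z _ => fcvg z)) int1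
  (aeW _ (fun z n _ => soft_step_le1 s n (a z))).
Qed.

End Step.

(** For each [n] the integral of the bounded C^1 function [soft_step s n] of [a] is the same at [t]
    and at 0; the measures of the superlevel sets are the limits in [n]. *)
Lemma transport_equimeasurable (R : realType) (T : \bar R)
    (a psi : R -> R * R -> R) (t : R) : vorticity_regular T a ->
  (forall t, lifespan T t -> periodic2 (psi t) /\ C2_space (psi t)) ->
  (forall t z, open_lifespan T t ->
     dt a t z + advect (velocity (psi t)) (a t) z = 0) ->
  lifespan T t -> equimeasurable (a t) (a 0).
Proof.
move=> ra C2 tr tT s.
have T0 : lifespan T 0.
  by case: tT => t0 tT; split => //; apply: le_lt_trans tT; rewrite lee_fin.
have ct := @cvg_integral_soft_step R _ s (@regular_continuous R T a ra t tT).
have c0 := @cvg_integral_soft_step R _ s (@regular_continuous R T a ra 0 T0).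
apply: (cvg_unique _ ct); first exact: ereal_hausdorff.
apply: cvg_trans c0; apply: near_eq_cvg; apply: nearW => n.
exact/esym/(observable_conserved ra C2 tr (@derivable_soft_step R s n)
  (@continuous_derive1_soft_step R s n) (soft_step_le1 s n) tT).
Qed.

(** * The supremum norm is a rearrangement-invariant seminorm *)

Section SupNorm.
Context {R : realType}.
Implicit Types a b : R * R -> R.

Lemma periodic_nat (f : R -> R) : (forall x, f (x + 1) = f x) ->
  forall n x, f (x + n%:R) = f x.
Proof.
move=> pf; elim=> [|n IH] x; first by rewrite addr0.
by rewrite -natr1 addrA pf IH.
Qed.

Lemma periodic_unit_interval (f : R -> R) : (forall x, f (x + 1) = f x) ->
  forall x, exists2 x', 0 <= x' <= 1 & f x' = f x.
Proof.
move=> pf x; exists (x - (Num.floor x)%:~R).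
  by rewrite subr_ge0 floor_le lerBlDl -intrD1 ltW// floorD1_gt.
(* A nonnegative floor is undone by adding [n] periods to the fractional part; for a negative one,
   the fractional part is [x] plus [n + 1] periods. *)
case: (Num.floor x) => n.
  by rewrite -(periodic_nat pf n (x - n%:~R)) -pmulrn subrK.
by rewrite NegzE mulrNz opprK; exact: periodic_nat.
Qed.

Lemma periodic2_cell a : periodic2 a ->
  forall z, exists2 w, torus_cell R w & a w = a z.
Proof.
move=> pa [x y].
have [x' x'01 ax'] := periodic_unit_interval (f := fun s => a (s, y))
  (fun s => (pa s y).1) x.
have [y' y'01 ay'] := periodic_unit_interval (f := fun s => a (x', s))
  (fun s => (pa x' s).2) y.
by exists (x', y'); [split; rewrite /= in_itv|rewrite ay' ax'].
Qed.

Lemma norm_sup_le a (M : R) : (forall z, `|a z| <= M) -> norm_sup a <= M.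
Proof.
move=> aM; apply: ge_sup; first by exists `|a (0, 0)|, (0, 0).
by move=> _ [z _ <-].
Qed.

(** The supremum is genuine because every value is already taken on the compact cell. *)
Lemma norm_sup_ge a z : continuous_torus a -> `|a z| <= norm_sup a.
Proof.
move=> [ca pa]; apply: ub_le_sup; last by exists z.
have [M aM] := continuous_bounded_torus ca.
by exists M => _ [w _ <-]; have [w' cw' <-] := periodic2_cell pa w; exact: aM.
Qed.

Lemma seminorm_norm_sup : seminorm_torus (@norm_sup R).
Proof.
have leZ (c : R) a : continuous_torus a ->
    norm_sup (fun z => c * a z) <= `|c| * norm_sup a.
  move=> ta; apply: norm_sup_le => z.
  by rewrite normrM ler_wpM2l// norm_sup_ge.
have torusZ (c : R) a : continuous_torus a -> continuous_torus (fun z => c * a z).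
  move=> [ca pa]; split; first by apply: continuousM2 => // z; exact: cvg_cst.
  by move=> x y; have [px py] := pa x y; rewrite px py.
split=> [a b ta tb|c a ta].
  apply: norm_sup_le => z; apply: le_trans (ler_normD _ _) _.
  by rewrite lerD// norm_sup_ge.
apply/eqP; rewrite eq_le leZ//=; have [->|c0] := eqVneq c 0.
  rewrite normr0 mul0r; apply: le_trans (norm_sup_ge (0, 0) (torusZ 0 a ta)).
  exact: normr_ge0.
rewrite mulrC -ler_pdivlMr ?normr_gt0// mulrC -normfV.
(* The reverse inequality is [leZ] for the factor [c^-1] and the function [c * a]. *)
apply: le_trans (leZ c^-1 _ (torusZ c a ta)); rewrite le_eqVlt; apply/orP; left.
by apply/eqP; congr norm_sup; apply/funext => z; rewrite mulKf.
Qed.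

(** Here [x] may be an endpoint of the unit interval, so the subinterval extends from [x] towards
    the farther end. *)
Lemma unit_subinterval (x r : R) : 0 <= x <= 1 -> 0 < r ->
  exists c d : R, c < d /\ `[c, d] `<=` `[0, 1] `&` ball x r.
Proof.
(* This length is less than [r] and at most one half, the room available on the farther side of
   [x]. *)
move=> /andP[x0 x1] r0; pose k := Num.min r 1 / 2.
have k0 : 0 < k by rewrite divr_gt0// lt_min r0 ltr01.
have kr : k < r.
  by rewrite ltr_pdivrMr// (le_lt_trans (y := r)) ?ge_min ?lexx// ltr_pMr// ltr1n.
have k1 : k <= 2^-1 by rewrite ler_pdivrMr// mulVf// ge_min lexx orbT.
have k1' : 2 * k <= 1 by lra.
have [xh|xh] := leP (2 * x) 1.
  exists x, (x + k); split; first by rewrite ltrDl.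
  move=> s /=; rewrite !in_itv/= => /andP[xs sx]; split.
    by apply/andP; split; lra.
  by rewrite /ball/= ltr_norml; apply/andP; split; lra.
exists (x - k), x; split; first by rewrite ltrBlDr ltrDl.
move=> s /=; rewrite !in_itv/= => /andP[xs sx]; split.
  by apply/andP; split; lra.
by rewrite /ball/= ltr_norml; apply/andP; split; lra.
Qed.

Lemma lebesgue2_open_gt0 (U : set (R * R)) z : open U -> U z ->
  torus_cell R z -> (0 < lebesgue2 R (U `&` torus_cell R))%E.
Proof.
move=> oU Uz [z1 z2].
have [r r0 zrU] : exists2 r : R, 0 < r & ball z r `<=` U.
  by move: oU; rewrite openE => /(_ _ Uz) /nbhs_ballP[r /= r0]; exists r.
have z1' : 0 <= z.1 <= 1 by move: z1; rewrite /= in_itv.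
have z2' : 0 <= z.2 <= 1 by move: z2; rewrite /= in_itv.
have [c [d [cd cdz]]] := unit_subinterval z1' r0.
have [c' [d' [cd' cdz']]] := unit_subinterval z2' r0.
have mE : (0 < lebesgue2 R (`[c, d] `*` `[c', d']))%E.
  rewrite /lebesgue2 product_measure1E//= !lebesgue_measure_itv/= !lte_fin cd cd'.
  by rewrite -!EFinB -EFinM lte_fin mulr_gt0// subr_gt0.
apply: lt_le_trans mE _; apply: (@le_measure _ _ _ (lebesgue2 R)).
- by rewrite inE; exact: measurableX.
- rewrite inE; apply: measurableI; first exact: (open_measurable2 oU).
  exact: measurable_torus_cell.
- move=> w [w1 w2]; have [w1c w1b] := cdz _ w1; have [w2c w2b] := cdz' _ w2.
  by split; [apply: zrU; split|split].
Qed.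

(** If [|a|] exceeded [M] somewhere, it would do so at a point of the cell and, by continuity, on a
    set of positive measure there; the corresponding set for [b] is empty. *)
Lemma equimeasurable_norm_le a b (M : R) : continuous_torus a ->
  continuous_torus b -> equimeasurable a b -> (forall z, `|b z| <= M) ->
  forall z, `|a z| <= M.
Proof.
move=> [ca pa] [cb pb] ab bM z; rewrite leNgt; apply/negP => Maz.
have [w cw aw] := periodic2_cell pa z; rewrite -aw in Maz.
pose B := [set x : R | M < `|x|].
have oB : open B.
  have /continuousP/(_ _ (@open_gt R M)) := @norm_continuous R R.
  exact: id.
have oaB : open (a @^-1` B) by move/continuousP: ca; apply.
have := lebesgue2_open_gt0 oaB Maz cw.
rewrite (equimeasurable_preimage (continuous_measurable2 ca)
  (continuous_measurable2 cb) ab (open_measurable oB)).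
have -> : b @^-1` B = set0.
  by apply/seteqP; split => // x; rewrite /B /= ltNge bM.
by rewrite set0I (measure0 (lebesgue2 R)) ltxx.
Qed.

Lemma rearrangement_invariant_norm_sup : rearrangement_invariant (@norm_sup R).
Proof.
move=> a b ta tb ab; apply/eqP; rewrite eq_le; apply/andP; split.
  apply: norm_sup_le; apply: (equimeasurable_norm_le ta tb ab) => z.
  exact: norm_sup_ge.
apply: norm_sup_le; apply: (equimeasurable_norm_le tb ta) => [s|z].
  by rewrite ab.
exact: norm_sup_ge.
Qed.

End SupNorm.

(** * Linearity of the operators and stability of the regularity classes *)

Section Linearity.
Context {R : realType}.
Implicit Types (a b psi : R * R -> R) (u v : R * R -> R * R).

Lemma has_partialsB a b : has_partials a -> has_partials b ->
  has_partials (a \- b).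
Proof.
by move=> pa pb z; split; apply: derivableB;
  [exact: (pa z).1|exact: (pb z).1|exact: (pa z).2|exact: (pb z).2].
Qed.

Lemma has_partialsD a b : has_partials a -> has_partials b ->
  has_partials (a \+ b).
Proof.
by move=> pa pb z; split; apply: derivableD;
  [exact: (pa z).1|exact: (pb z).1|exact: (pa z).2|exact: (pb z).2].
Qed.

Lemma dxB a b : has_partials a -> has_partials b -> dx (a \- b) = dx a \- dx b.
Proof.
move=> pa pb; apply/funext => z; rewrite /dx /= !derive1E.
exact: (deriveB (pa z).1 (pb z).1).
Qed.

Lemma dyB a b : has_partials a -> has_partials b -> dy (a \- b) = dy a \- dy b.
Proof.
move=> pa pb; apply/funext => z; rewrite /dy /= !derive1E.
exact: (deriveB (pa z).2 (pb z).2).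
Qed.

Lemma dxD a b : has_partials a -> has_partials b -> dx (a \+ b) = dx a \+ dx b.
Proof.
move=> pa pb; apply/funext => z; rewrite /dx /= !derive1E.
exact: (deriveD (pa z).1 (pb z).1).
Qed.

Lemma dyD a b : has_partials a -> has_partials b -> dy (a \+ b) = dy a \+ dy b.
Proof.
move=> pa pb; apply/funext => z; rewrite /dy /= !derive1E.
exact: (deriveD (pa z).2 (pb z).2).
Qed.

Lemma C1_spaceD a b : C1_space a -> C1_space b -> C1_space (a \+ b).
Proof.
move=> [ca pa cxa cya] [cb pb cxb cyb]; split.
- exact: continuousD2 ca cb.
- exact: has_partialsD.
- by rewrite dxD//; exact: continuousD2 cxa cxb.
- by rewrite dyD//; exact: continuousD2 cya cyb.
Qed.

Lemma C2_spaceD a b : C2_space a -> C2_space b -> C2_space (a \+ b).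
Proof.
move=> [C1a C1xa C1ya] [C1b C1xb C1yb].
have [_ pa _ _] := C1a; have [_ pb _ _] := C1b.
split; first exact: C1_spaceD C1a C1b.
- by rewrite (dxD pa pb); exact: C1_spaceD C1xa C1xb.
- by rewrite (dyD pa pb); exact: C1_spaceD C1ya C1yb.
Qed.

Lemma advectB u a b z : has_partials a -> has_partials b ->
  advect u (a \- b) z = advect u a z - advect u b z.
Proof.
move=> pa pb; rewrite /advect dxB// dyB//=.
by move: (u z) (dx a z) (dx b z) (dy a z) (dy b z) => [p q] ? ? ? ?; ring.
Qed.

Lemma advectD u v a z : advect (u \+ v) a z = advect u a z + advect v a z.
Proof.
rewrite /advect /=.
by move: (u z) (v z) (dx a z) (dy a z) => [p q] [p' q'] ? ? /=; ring.
Qed.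

Lemma velocityD a b : has_partials a -> has_partials b ->
  velocity (a \+ b) = velocity a \+ velocity b.
Proof.
move=> pa pb; apply/funext => z; rewrite /velocity /gradperp dxD// dyD//=.
by congr pair => /=; rewrite ?opprK ?opprD ?opprK.
Qed.

Lemma dtB (T : \bar R) (a b : R -> R * R -> R) t z :
  vorticity_regular T a -> vorticity_regular T b -> open_lifespan T t ->
  dt (fun s => a s \- b s) t z = dt a t z - dt b t z.
Proof.
move=> ra rb tT; rewrite /dt !derive1E.
exact: (deriveB (@vr_derivable_t _ _ _ ra t z tT)
  (@vr_derivable_t _ _ _ rb t z tT)).
Qed.

(** The derivatives of a difference are known to split only at interior times; local equality is
    enough to transfer continuity. *)
Lemma continuous_near_eq (X : topologicalType) (F G : X -> R) (p : X) :
  {for p, continuous F} -> (\forall q \near p, F q = G q) ->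
  {for p, continuous G}.
Proof.
move=> cF FG; have FGp : F p = G p by exact: nbhs_singleton FG.
rewrite /prop_for /continuous_at -FGp.
by apply: cvg_trans cF; apply: near_eq_cvg; apply: filterS FG.
Qed.

Lemma open_lifespan_near_fst (T : \bar R) (p : R * (R * R)) :
  open_lifespan T p.1 -> \forall q \near p, open_lifespan T q.1.
Proof.
by case: p => t z /= tT; exact: (cvg_fst (open_lifespan_near tT)).
Qed.

Lemma vorticity_regularB (T : \bar R) (a b : R -> R * R -> R) :
  vorticity_regular T a -> vorticity_regular T b ->
  vorticity_regular T (fun t => a t \- b t).
Proof.
move=> ra rb; split.
- move=> t tT x y; have [ax ay] := vr_periodic ra tT x y.
  by have [bx by'] := vr_periodic rb tT x y; rewrite /= ax ay bx by'.
- apply/subspace_continuousP => p [pT _].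
  by apply: cvgB; exact: regular_within.
- move=> t z tT.
  exact: (derivableB (@vr_derivable_t _ _ _ ra t z tT)
    (@vr_derivable_t _ _ _ rb t z tT)).
- move=> t tT.
  exact: has_partialsB (vr_partials ra tT) (vr_partials rb tT).
- move=> p pT; apply: (@continuous_near_eq _
    (fun q : R * (R * R) => dt a q.1 q.2 - dt b q.1 q.2)).
    by apply: continuousB; [exact: (@vr_continuous_dt _ _ _ ra p pT)
      |exact: (@vr_continuous_dt _ _ _ rb p pT)].
  apply: filterS (open_lifespan_near_fst pT) => q qT.
  exact/esym/(dtB _ ra rb qT).
- move=> p pT; apply: (@continuous_near_eq _
    (fun q : R * (R * R) => dx (a q.1) q.2 - dx (b q.1) q.2)).
    by apply: continuousB; [exact: (@vr_continuous_dx _ _ _ ra p pT)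
      |exact: (@vr_continuous_dx _ _ _ rb p pT)].
  apply: filterS (open_lifespan_near_fst pT) => q qT.
  by rewrite (dxB (vr_partials ra qT) (vr_partials rb qT)).
- move=> p pT; apply: (@continuous_near_eq _
    (fun q : R * (R * R) => dy (a q.1) q.2 - dy (b q.1) q.2)).
    by apply: continuousB; [exact: (@vr_continuous_dy _ _ _ ra p pT)
      |exact: (@vr_continuous_dy _ _ _ rb p pT)].
  apply: filterS (open_lifespan_near_fst pT) => q qT.
  by rewrite (dyB (vr_partials ra qT) (vr_partials rb qT)).
Qed.

Lemma regular_continuous_torus (T : \bar R) (a : R -> R * R -> R) t :
  vorticity_regular T a -> lifespan T t -> continuous_torus (a t).
Proof.
move=> ra tT; split; last exact: (@vr_periodic _ _ _ ra t tT).
exact: (@regular_continuous _ _ _ ra t tT).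
Qed.

Lemma continuous_torusB a b : continuous_torus a -> continuous_torus b ->
  continuous_torus (a \- b).
Proof.
move=> [ca pa] [cb pb]; split; first exact: continuousB2 ca cb.
by move=> x y; have [ax ay] := pa x y; have [bx by'] := pb x y;
  rewrite /= ax ay bx by'.
Qed.

Lemma seminorm_torusB (N : (R * R -> R) -> R) a b : seminorm_torus N ->
  continuous_torus a -> continuous_torus b -> N (a \- b) <= N a + N b.
Proof.
move=> [ND NZ] ta tb.
have -> : a \- b = a \+ (fun z => -1 * b z).
  by apply/funext => z; rewrite /= mulN1r.
have tNb : continuous_torus (fun z => -1 * b z).
  case: tb => cb pb; split.
    by apply: continuousM2 => // z; exact: cvg_cst.
  by move=> x y; have [bx by'] := pb x y; rewrite bx by'.
by apply: le_trans (ND _ _ ta tNb) _; rewrite NZ// normrN1 mul1r.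
Qed.

End Linearity.

(** * The Euler-Euler system and its conservation laws *)

Section Main.
Context {R : realType}.
Variables (T : \bar R) (w1 w2 psi1 psi2 : R -> R * R -> R).
Hypotheses (w1_regular : vorticity_regular T w1)
  (w2_regular : vorticity_regular T w2)
  (w1_psi1 : stream_function T psi1 w1) (w2_psi2 : stream_function T psi2 w2).

Lemma euler_euler_transport_system :
  euler_euler T psi1 psi2 w1 w2 <-> transport_system T psi1 psi2 w1 w2.
Proof.
(* The first transport equation is the difference of the two original ones, the advection of [w2] by
   the second velocity cancelling; the second equation is common to both systems. *)
have E t z : open_lifespan T t -> dt (fun s => w1 s \- w2 s) t z
      + advect (velocity (psi1 t)) (w1 t \- w2 t) z =
    (dt w1 t z + advect (velocity (psi1 t)) (w1 t) z
      + advect (velocity (psi2 t)) (w2 t) z) -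
    (dt w2 t z + advect (velocity (psi1 t) \+ velocity (psi2 t)) (w2 t) z).
  move=> tT; rewrite (dtB z w1_regular w2_regular tT) advectD.
  rewrite (advectB _ _ (vr_partials w1_regular tT) (vr_partials w2_regular tT)).
  move: (dt w1 t z) (dt w2 t z) (advect _ (w1 t) z) (advect _ (w2 t) z)
    (advect _ (w2 t) z) => *; ring.
split=> sys t z tT; have [] := sys t z tT.
  by move=> eq1 eq2; rewrite E// eq1 eq2 subrr.
by move=> + eq2; rewrite E// eq2 subr0.
Qed.

Hypothesis sys : euler_euler T psi1 psi2 w1 w2.

Lemma equimeasurable_vorticities t : lifespan T t ->
  equimeasurable (w1 t \- w2 t) (w1 0 \- w2 0) /\ equimeasurable (w2 t) (w2 0).
Proof.
move=> tT; have tr := euler_euler_transport_system.1 sys; split.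
  apply: (@transport_equimeasurable R T (fun s => w1 s \- w2 s) psi1 t) tT.
  - exact: vorticity_regularB.
  - by move=> s /w1_psi1[].
  - by move=> s z /(tr s z)[].
(* The velocity transporting [w2] has stream function [psi1 + psi2], by linearity. *)
apply: (@transport_equimeasurable R T w2 (fun s => psi1 s \+ psi2 s) t) tT => //.
- move=> s sT; have [p1 C1 _] := w1_psi1 sT; have [p2 C2 _] := w2_psi2 sT.
  split; last exact: C2_spaceD.
  by move=> x y; have [p1x p1y] := p1 x y; have [p2x p2y] := p2 x y;
    rewrite /= p1x p1y p2x p2y.
- move=> s z sT; have [_ [[_ hp1 _ _] _ _] _] := w1_psi1 (open_lifespanW sT).
  have [_ [[_ hp2 _ _] _ _] _] := w2_psi2 (open_lifespanW sT).
  by rewrite (velocityD hp1 hp2); have [] := tr s z sT.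
Qed.

Lemma seminorm_vorticities (N : (R * R -> R) -> R) :
  seminorm_torus N -> rearrangement_invariant N ->
  forall t, lifespan T t ->
    [/\ N (w1 t \- w2 t) = N (w1 0 \- w2 0),
        N (w2 t) = N (w2 0),
        N (w1 t) <= N (w1 t \- w2 t) + N (w2 t),
        N (w1 t \- w2 t) + N (w2 t) <= N (w1 0 \- w2 0) + N (w2 0) &
        N (w1 0 \- w2 0) + N (w2 0) <= N (w1 0) + 2 * N (w2 0)].
Proof.
move=> sN rN t tT.
have T0 : lifespan T 0.
  by case: tT => t0 tT; split => //; apply: le_lt_trans tT; rewrite lee_fin.
have torus1 s (sT : lifespan T s) := regular_continuous_torus w1_regular sT.
have torus2 s (sT : lifespan T s) := regular_continuous_torus w2_regular sT.
have torusB s sT := continuous_torusB (torus1 s sT) (torus2 s sT).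
have [eB e2] := equimeasurable_vorticities tT.
have NB := rN _ _ (torusB t tT) (torusB 0 T0) eB.
have N2 := rN _ _ (torus2 t tT) (torus2 0 T0) e2.
split => //; last 2 first.
- by rewrite NB N2.
- rewrite mulrDl mul1r addrA lerD2r.
  exact: seminorm_torusB (torus1 0 T0) (torus2 0 T0).
have {1}-> : w1 t = (w1 t \- w2 t) \+ w2 t by apply/funext => z; rewrite /= subrK.
exact: sN.1 (torusB t tT) (torus2 t tT).
Qed.

End Main.

Theorem mainTheorem1 (R : realType) (T : \bar R)
    (w1 w2 psi1 psi2 : R -> R * R -> R) (T_gt0 : (0 < T)%E)
    (w1_regular : vorticity_regular T w1)
    (w2_regular : vorticity_regular T w2)
    (w1_psi1 : stream_function T psi1 w1)
    (w2_psi2 : stream_function T psi2 w2) :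
  (euler_euler T psi1 psi2 w1 w2 <-> transport_system T psi1 psi2 w1 w2) /\
  (euler_euler T psi1 psi2 w1 w2 ->
   [/\ forall f g : R -> R,
         measurable_fun setT f -> measurable_fun setT g ->
         integrable_torus (f \o (w1 0 \- w2 0)) ->
         integrable_torus (g \o w2 0) ->
         forall t, lifespan T t ->
           [/\ integrable_torus (f \o (w1 t \- w2 t)),
               integrable_torus (g \o w2 t) &
               casimir f g (w1 t) (w2 t) = casimir f g (w1 0) (w2 0)],
       forall N : (R * R -> R) -> R,
         seminorm_torus N -> rearrangement_invariant N ->
         forall t, lifespan T t ->
           [/\ N (w1 t \- w2 t) = N (w1 0 \- w2 0),
               N (w2 t) = N (w2 0),
               N (w1 t) <= N (w1 t \- w2 t) + N (w2 t),
               N (w1 t \- w2 t) + N (w2 t) <= N (w1 0 \- w2 0) + N (w2 0) &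
               N (w1 0 \- w2 0) + N (w2 0) <= N (w1 0) + 2 * N (w2 0)] &
       forall t, lifespan T t ->
         norm_sup (w1 t) <= norm_sup (w1 0) + 2 * norm_sup (w2 0) /\
         norm_sup (w2 t) <= norm_sup (w2 0)]).
Proof.
split; first exact: euler_euler_transport_system.
move=> sys; have seminorms := seminorm_vorticities w1_regular w2_regular
  w1_psi1 w2_psi2 sys.
split; [|exact: seminorms|]; last first.
  move=> t tT; have [_ -> le1 le2 le3] := seminorms _ (@seminorm_norm_sup R)
    (@rearrangement_invariant_norm_sup R) t tT.
  by split; [exact: le_trans (le_trans le1 le2) le3|exact: lexx].
move=> f g mf mg fi gi t tT.
have T0 : lifespan T 0 by split.
have m1 s (sT : lifespan T s) : measurable_fun setT (w1 s \- w2 s).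
  exact: continuous_measurable2 (@regular_continuous _ _ _
    (vorticity_regularB w1_regular w2_regular) s sT).
have m2 s (sT : lifespan T s) : measurable_fun setT (w2 s).
  exact: continuous_measurable2 (@regular_continuous _ _ _ w2_regular s sT).
have [e1 e2] := equimeasurable_vorticities w1_regular w2_regular
  w1_psi1 w2_psi2 sys tT.
(* Integrability is carried from time 0 to time [t], so equimeasurability is needed in the opposite
   direction. *)
have e1' s : _ = _ := esym (e1 s); have e2' s : _ = _ := esym (e2 s).
have fit := integrable_equimeasurable (m1 0 T0) (m1 t tT) e1' mf fi.
have git := integrable_equimeasurable (m2 0 T0) (m2 t tT) e2' mg gi.
have mcell := @measurable_torus_cell R.
have split_casimir (a b : R * R -> R) : measurable_fun setT (a \- b) ->
    measurable_fun setT b -> integrable_torus (f \o (a \- b)) ->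
    integrable_torus (g \o b) ->
    casimir f g a b = \int[lebesgue2 R]_(z in torus_cell R) f ((a \- b) z) +
      \int[lebesgue2 R]_(z in torus_cell R) g (b z).
  move=> mab mb fab gb.
  have mfg : measurable_fun setT (fun z => (f ((a \- b) z) + g (b z))%:E).
    apply/measurable_EFinP; apply: measurable_funD.
      exact: measurableT_comp mf mab.
    exact: measurableT_comp mg mb.
  rewrite /casimir /Rintegral.
  (* The two measurable structures on [R * R] are reconciled before additivity of the integral is
     used. *)
  apply: etrans (congr1 fine (esym (integral_lebesgue2 mcell mfg))) _.
  exact: (@RintegralD _ _ _ (lebesgue2 R) _ _ _ mcell fab gb).
split; [exact: fit|exact: git|].
rewrite (split_casimir _ _ (m1 t tT) (m2 t tT) fit git).
rewrite (split_casimir _ _ (m1 0 T0) (m2 0 T0) fi gi).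
congr (_ + _).
- exact: (integral_equimeasurable (m1 t tT) (m1 0 T0) e1 mf).
- exact: (integral_equimeasurable (m2 t tT) (m2 0 T0) e2 mg).
Qed.
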